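(* Let $q$ be a prime power and let $m,n$ be positive integers with $m<n$. Then $$\binom{n-m+1}{1}_q\leq \chi(J_q(n,m))\leq \binom{n}{1}_q.$$
   Context: For integers $n\ge m\ge 0$, the Gaussian binomial coefficient is $\binom{n}{m}_q=\frac{(q^n-1)(q^{n-1}-1)\cdots(q^{n-m+1}-1)}{(q-1)(q^2-1)\cdots(q^m-1)}$; in particular $\binom{n}{1}_q=\frac{q^n-1}{q-1}$. The Grassmann graph $J_q(n,m)$ is the graph whose vertices are the $m$-dimensional subspaces of $\mathbb{F}_q^n$, two vertices being adjacent if they intersect in an $(m-1)$-dimensional subspace. $\chi(G)$ denotes the chromatic number of a graph $G$. *)

(* Defs.v *)
From HB Require Import structures.
From mathcomp Require Import all_boot all_order all_algebra.

Set Implicit Arguments.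
Unset Strict Implicit.
Unset Printing Implicit Defensive.

(* The library only makes {vspace vT} a choiceType; its subtype structure, with
   projection the normalized matrix of a subspace, is kept in
   VectorInternalTheory. *)
Section VspaceFinite.
Import VectorInternalTheory.
Variables (F : finFieldType) (vT : vectType F).
HB.instance Definition _ := [Countable of {vspace vT} by <:].
HB.instance Definition _ := [Finite of {vspace vT} by <:].
End VspaceFinite.

Definition prime_power (q : nat) : Prop :=
  exists p k : nat, [/\ prime p, 0 < k & q = p ^ k].

Definition gauss_num (q n m : nat) : nat := \prod_(0 <= i < m) (q ^ (n - i) - 1).
Definition gauss_den (q m : nat) : nat := \prod_(1 <= i < m.+1) (q ^ i - 1).

(* The quotient is exact, by dvd_gauss below. *)
Definition gauss_binomial (q n m : nat) : nat := gauss_num q n m %/ gauss_den q m.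

Lemma dvd_gauss (q n m : nat) : 0 < q -> gauss_den q m %| gauss_num q n m.
Proof.
move=> q_gt0; elim: n m => [|n IHn] [|m].
- by rewrite /gauss_den big_geq ?dvd1n.
- by rewrite /gauss_num big_nat_recl // subn0 expn0 subnn mul0n dvdn0.
- by rewrite /gauss_den big_geq ?dvd1n.
have numSS : gauss_num q n.+1 m.+1 = (q ^ n.+1 - 1) * gauss_num q n m.
  by rewrite /gauss_num big_nat_recl.
have denS : gauss_den q m.+1 = gauss_den q m * (q ^ m.+1 - 1).
  by rewrite /gauss_den big_nat_recr.
have [lt_nm | le_mn] := ltnP n m.
  have -> : gauss_num q n.+1 m.+1 = 0; last exact: dvdn0.
  rewrite /gauss_num big_mkord (bigD1 (Ordinal (lt_nm : n.+1 < m.+1))) //=.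
  by rewrite subnn.
have -> : gauss_num q n.+1 m.+1
    = q ^ (n - m) * ((q ^ m.+1 - 1) * gauss_num q n m) + gauss_num q n m.+1.
  have -> : gauss_num q n m.+1 = gauss_num q n m * (q ^ (n - m) - 1).
    by rewrite /gauss_num big_nat_recr.
  rewrite numSS mulnA [_ * (_ - 1)]mulnC [in RHS]mulnC -mulnDr mulnC.
  congr (_ * _); rewrite mulnBl mul1n -expnD addSn subnKC //.
  by rewrite addnBA ?expn_gt0 ?q_gt0 // subnK // leq_pexp2l // leqW // leq_subr.
by rewrite dvdn_add ?IHn // dvdn_mull // denS mulnC dvdn_mul.
Qed.

Record sgraph := SGraph {
  vertex :> finType;
  adj : rel vertex;
  adj_sym : symmetric adj;
  adj_irrefl : irreflexive adj
}.

Definition proper_coloring (G : sgraph) (k : nat) (f : {ffun G -> 'I_k}) : bool :=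
  [forall x, forall y, adj x y ==> (f x != f y)].

Definition colorable (G : sgraph) (k : nat) : bool :=
  [exists f : {ffun G -> 'I_k}, proper_coloring f].

Lemma colorable_exists (G : sgraph) : exists k, colorable G k.
Proof.
exists #|G|; apply/existsP; exists [ffun x => enum_rank x].
apply/forallP => x; apply/forallP => y; apply/implyP => xy.
rewrite !ffunE; apply/negP => /eqP/enum_rank_inj exy.
by move: xy; rewrite exy adj_irrefl.
Qed.

Definition chromatic_number (G : sgraph) : nat := ex_minn (colorable_exists G).

Section Grassmann.
Variables (F : finFieldType) (n m : nat).

Definition msubspace : finType := {U : {vspace 'rV[F]_n} | \dim U == m}.

(* "dim = m - 1", written so that for m = 0 nothing is adjacent: with truncated
   subtraction the zero subspace would be adjacent to itself. *)
Definition grassmann_adj : rel msubspace :=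
  fun U W => (\dim (val U :&: val W)).+1 == m.

Lemma grassmann_adj_sym : symmetric grassmann_adj.
Proof. by move=> U W; rewrite /grassmann_adj capvC. Qed.

Lemma grassmann_adj_irrefl : irreflexive grassmann_adj.
Proof.
by move=> U; rewrite /grassmann_adj capvv (eqP (valP U)) eqn_leq ltnn.
Qed.

Definition grassmann_graph : sgraph :=
  SGraph grassmann_adj_sym grassmann_adj_irrefl.

End Grassmann.

(* Main.v *)
(** Lower bound: the m-spaces through a fixed (m-1)-space form a clique.

    Upper bound: embed the ambient space F-linearly into the field L of degree n
    over F. The Moore determinant det (s_i ^ (q ^ j)) of a basis s of an m-space
    U is nonzero, and a change of basis multiplies it by an element of F^*, so
    its (q-1)-st power depends only on U; being a (q-1)-st power in L^*, it is a
    root of unity of order dividing (q^n-1)/(q-1), and we use it as the colour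
    of U. If U = I + <u> and W = I + <w> had the same colour, where I is their
    intersection, of dimension m-1, then by additivity of the determinant in
    its first row the determinant of the free family (u - c w, basis of I)
    would vanish for some c in F. *)

Require Import Defs.
From HB Require Import structures.
From mathcomp Require Import all_boot all_order all_algebra.
From mathcomp Require Import all_fingroup all_solvable all_field.

Set Implicit Arguments.
Unset Strict Implicit.
Unset Printing Implicit Defensive.

Import GRing.Theory FinRing.Theory.

(** * Frobenius automorphism and finite extensions of every degree *)

Section FiniteFieldExtension.
Local Open Scope ring_scope.
Variable F : finFieldType.

Lemma Frobenius_gal (L : splittingFieldType F) :
  exists alpha : gal_of {:L}, forall x : L, alpha x = x ^+ #|F|.
Proof.
have /finField_galois_generator[/= a _ Da] : (1 <= {:L})%VS by apply: sub1v.
by exists a => x; rewrite Da ?memvf // dimv1 expn1.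
Qed.

Lemma Frobenius_galX (L : splittingFieldType F) (alpha : gal_of {:L}) j x :
  (forall y : L, alpha y = y ^+ #|F|) -> (alpha ^+ j)%g x = x ^+ (#|F| ^ j).
Proof.
move=> alphaE; elim: j => [|j IHj]; first by rewrite gal_id.
by rewrite expgSr galM ?memvf // IHj alphaE -exprM -expnSr.
Qed.

(** The splitting field of X^(q^n) - X consists of exactly the q^n distinct roots of this
    polynomial. *)
Lemma exists_finField_ext (n : nat) : (0 < n)%N ->
  exists L : splittingFieldType F, \dim {:L} = n.
Proof.
move=> n_gt0; pose q := #|F|; pose Q := (q ^ n)%N.
have q_gt1 : (1 < q)%N := finNzRing_gt1 F.
have Q_gt1 : (1 < Q)%N by rewrite -(expn0 q) ltn_exp2l.
pose P (R : nzRingType) : {poly R} := 'X^Q - 'X.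
have DP R : P R = ('X^(Q.-1) - 1) * ('X - 0).
  by rewrite subr0 mulrBl mul1r -exprSr prednK // ltnW.
have nzP : P F != 0.
  rewrite DP monic_neq0 ?rpredM ?monicXsubC ?monicXnsubC //.
  by rewrite -subn1 subn_gt0.
have [L [zs DPL defL]] := FinSplittingFieldFor nzP; exists L.
rewrite rmorphB rmorphXn /= map_polyX -/(P L) in DPL.
have natQ0 : Q%:R = 0 :> L.
  have qF0 : q%:R = 0 :> F by rewrite -zmodXgE /q -cardsT expg_cardG ?inE.
  by rewrite natrX -(rmorph_nat (in_alg L)) qF0 rmorph0 expr0n gtn_eqF.
(* The factor X^(Q-1) - 1 is separable since Q - 1 = -1 is nonzero in L, and 0 is not one of its
   roots. *)
have Uzs : uniq zs.
  rewrite -separable_prod_XsubC -(eqp_separable DPL) DP separable_root andbC.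
  rewrite /root !hornerE subr_eq0 eq_sym expr0n gtn_eqF ?oner_eq0; last first.
    by rewrite -subn1 subn_gt0.
  rewrite cyclotomic.separable_Xn_sub_1 // -subn1 natrB ?(ltnW Q_gt1) //.
  by rewrite natQ0 sub0r oppr_eq0 oner_eq0.
have [alpha alphaE] := Frobenius_gal L.
(* The roots are the fixed points of [alpha ^+ n], hence a subfield; since they generate L, they
   fill it. *)
pose Em := fixedSpace (alpha ^+ n)%g; have in_zs : zs =i Em.
  move=> z; rewrite -root_prod_XsubC -(eqp_root DPL) (sameP fixedSpaceP eqP).
  by rewrite /root !hornerE subr_eq0 Frobenius_galX.
have fixL : Em = {:L}%VS.
  apply/eqP; rewrite eqEsubv subvf -defL -[Em]subfield_closed agenvS //.
  by rewrite subv_add sub1v; apply/span_subvP=> z; rewrite in_zs.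
pose Fm := FinFieldExtType L.
have cardL : #|Fm| = Q.
  have /eq_card-> : Fm =i zs by move=> z; rewrite in_zs fixL memvf.
  apply: succn_inj; rewrite (card_uniqP _) //= -(size_prod_XsubC _ id).
  by rewrite -(eqp_size DPL) size_polyDl size_polyXn // size_polyN size_polyX.
apply/eqP; rewrite -(eqn_exp2l _ _ q_gt1) -/Q -cardL.
by rewrite -(@card_vspacef F Fm (Vector.class L)) card_vspace.
Qed.

(** * Moore determinants and the colour of a subspace *)

Section MooreDeterminant.
Variables (vT : vectType F) (L : splittingFieldType F).
Variables (phi : {linear vT -> L}) (alpha : gal_of {:L}).
Hypothesis phi_inj : injective phi.
Hypothesis alphaE : forall x : L, alpha x = x ^+ #|F|.

(* The entries are the powers phi(s_i)^(q^j); written as values of the j-th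
   power of the Frobenius automorphism, they are visibly F-linear in s_i. *)
Definition moore_det (m : nat) (s : seq vT) : L :=
  \det (\matrix_(i < m, j < m) (alpha ^+ j)%g (phi s`_i)).

(* A linear relation between the columns is a polynomial of degree at most
   q^(m-1) that vanishes on the q^m images of the vectors of the span. *)
Lemma moore_det_neq0 m (s : m.-tuple vT) : free s -> moore_det m s != 0.
Proof.
move=> free_s; apply/negP; rewrite /moore_det -det_tr => /det0P[v v_neq0 vA0].
have [j0 vj0] : exists j, v 0 j != 0 by apply/rV0Pn.
pose p := \sum_(j < m) v 0 j *: 'X^(#|F| ^ j).
have hornerp y : p.[y] = \sum_(j < m) v 0 j * (alpha ^+ j)%g y.
  rewrite horner_sum; apply: eq_bigr => j _.
  by rewrite !hornerE Frobenius_galX.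
have q_gt1 : (1 < #|F|)%N := finNzRing_gt1 F.
(* The exponents q^j are distinct, so the coefficient of p at q^j0 is [v 0 j0]. *)
have p_neq0 : p != 0.
  apply: contraNneq vj0 => p0.
  have := congr1 (fun r : {poly L} => r`_(#|F| ^ j0)) p0.
  rewrite coef0 coef_sum (bigD1 j0) //= coefZ coefXn eqxx mulr1 big1 ?addr0.
    by move=> ->.
  move=> j ne_j; rewrite coefZ coefXn eqn_exp2l // eq_sym.
  by rewrite -(inj_eq val_inj) in ne_j; rewrite (negPf ne_j) mulr0.
have size_p : (size p <= (#|F| ^ m.-1).+1)%N.
  apply: (leq_trans (size_sum _ _ _)); apply/bigmax_leqP => j _.
  rewrite (leq_trans (size_scale_leq _ _)) // size_polyXn ltnS leq_exp2l //.
  by rewrite -ltnS prednK // (leq_ltn_trans _ (ltn_ord j)).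
have root_p (i : 'I_m) : p.[phi s`_i] = 0.
  rewrite hornerp; have /rowP/(_ i) := vA0; rewrite !mxE => vA0i.
  by rewrite -[RHS]vA0i; apply: eq_bigr => j _; rewrite !mxE.
pose comb (x : 'rV[F]_m) := phi (\sum_(i < m) x 0 i *: s`_i).
have comb_inj : injective comb.
  move=> x y /phi_inj eq_xy; apply/rowP => i.
  by rewrite -(coord_sum_free (x 0) i free_s) eq_xy coord_sum_free.
pose rs := [seq comb x | x : 'rV[F]_m].
have uniq_rs : uniq rs by rewrite map_inj_uniq ?enum_uniq.
have all_rs : all (root p) rs.
  apply/allP => _ /codomP[x ->]; rewrite rootE hornerp.
  under eq_bigr do rewrite /comb !linear_sum mulr_sumr.
  rewrite exchange_big big1 //= => i _.
  transitivity ((x 0 i)%:A * p.[phi s`_i]); last by rewrite root_p mulr0.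
  rewrite hornerp mulr_sumr.
  by apply: eq_bigr => j _; rewrite !linearZ /= mulr_algl scalerAr.
(* This yields q^m <= q^(m-1), absurd because the index [j0] forces m > 0. *)
have := leq_trans (max_poly_roots p_neq0 all_rs uniq_rs) size_p.
rewrite size_codom card_mx mul1n.
by rewrite ltnS leq_exp2l // leqNgt ltn_predL (leq_ltn_trans _ (ltn_ord j0)).
Qed.

(** By F-linearity of the powers of [alpha], one coordinate matrix over F serves all columns; c is
    its determinant. *)
Lemma moore_det_subv m (s t : m.-tuple vT) :
  (<<s>> <= <<t>>)%VS -> exists c : F, moore_det m s = c%:A * moore_det m t.
Proof.
move=> sub_st; pose C := \matrix_(i < m, j < m) coord t j s`_i.
exists (\det C); rewrite -in_algE -det_map_mx -det_mulmx; congr (\det _).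
apply/matrixP => i j; rewrite !mxE.
rewrite [s`_i in LHS](@coord_span _ _ _ t); last first.
  by rewrite (subvP sub_st) // memv_span // mem_nth ?size_tuple.
rewrite !linear_sum; apply: eq_bigr => k _.
by rewrite !mxE !linearZ /= mulr_algl.
Qed.

Lemma moore_det_head m (u v : vT) (s : seq vT) (c : F) :
  moore_det m.+1 (u - c *: v :: s)
    = moore_det m.+1 (u :: s) - c%:A * moore_det m.+1 (v :: s).
Proof.
rewrite -[moore_det _ (u :: s)]mul1r -mulNr.
apply: (determinant_multilinear (i0 := 0)).
- by apply/rowP => j; rewrite !mxE /= mul1r mulNr mulr_algl !linearB !linearZ.
- by apply/matrixP => i j; rewrite !mxE.
- by apply/matrixP => i j; rewrite !mxE.
Qed.

Lemma alg_expf_pred_card (c : F) : c != 0 -> (c%:A : L) ^+ #|F|.-1 = 1.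
Proof.
move=> c_neq0; rewrite -in_algE -rmorphXn -(rmorph1 (in_alg L)); congr (_%:A).
apply: (mulfI c_neq0); rewrite -exprS prednK ?expf_card ?mulr1 //.
by rewrite ltnW // finNzRing_gt1.
Qed.

(** The quotient x / y satisfies z^q = z, which characterizes the elements of F in L. *)
Lemma eq_expf_pred_card (x y : L) : y != 0 ->
  x ^+ #|F|.-1 = y ^+ #|F|.-1 -> exists c : F, x = c%:A * y.
Proof.
move=> y_neq0 eq_xy; suff /vlineP[c xy] : x / y \in 1%VS.
  by exists c; rewrite -xy divfK.
rewrite Fermat's_little_theorem dimv1 expn1 -(ltn_predK (finNzRing_gt1 F)).
by rewrite exprS expr_div_n eq_xy divff ?mulr1 // expf_neq0.
Qed.

Definition moore_color (U : {vspace vT}) : L :=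
  moore_det (\dim U) (vbasis U) ^+ #|F|.-1.

Lemma moore_colorE m (s : m.-tuple vT) (U : {vspace vT}) :
  basis_of U s -> moore_color U = moore_det m s ^+ #|F|.-1.
Proof.
move=> basis_s; rewrite /moore_color; move: (vbasis U) (vbasisP U).
rewrite (size_basis basis_s).
move=> t basis_t; have sub_ts : (<<t>> <= <<s>>)%VS.
  by rewrite (span_basis basis_s) (span_basis basis_t).
have [c st] := moore_det_subv sub_ts.
rewrite st exprMn alg_expf_pred_card ?mul1r //.
apply: contraNneq (moore_det_neq0 (basis_free basis_t)) => c0.
by rewrite st c0 scale0r mul0r.
Qed.

Lemma moore_color_adj (U W : {vspace vT}) :
  \dim U = \dim W -> (\dim (U :&: W)).+1 = \dim U ->
  moore_color U != moore_color W.
Proof.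
move=> eq_dim dimUW; set I := (U :&: W)%VS in dimUW; pose s := vbasis I.
have basisI := vbasisP I.
have ext X : \dim X = \dim U -> (I <= X)%VS ->
    exists2 x, x \in X & (x \notin I) /\ basis_of X (x :: s).
  move=> dimX sIX; have /subvPn[x Xx Ix] : ~~ (X <= I)%VS.
    apply: contraL (eqxx (\dim U)) => /dimvS.
    by rewrite dimX -dimUW ltnn.
  exists x => //; split=> //; rewrite basisEfree free_cons (span_basis basisI).
  rewrite Ix (basis_free basisI) span_cons (span_basis basisI) subv_add sIX.
  by rewrite -memvE Xx /= size_tuple dimX dimUW.
have [u Uu [Iu basisU]] := ext U erefl (capvSl _ _).
have [w Ww [Iw basisW]] := ext W (esym eq_dim) (capvSr _ _).
rewrite (moore_colorE (s := [tuple of u :: s]) basisU).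
rewrite (moore_colorE (s := [tuple of w :: s]) basisW); apply/eqP.
case/eq_expf_pred_card; first exact: moore_det_neq0 (basis_free basisW).
move=> c /eqP; rewrite -subr_eq0 -moore_det_head; apply/negP.
apply: (@moore_det_neq0 _ [tuple of u - c *: w :: s]).
rewrite free_cons (basis_free basisI) andbT (span_basis basisI).
(* If u - c w were in I, then u would lie in W, hence in I. *)
apply: contra Iu => Iuw; rewrite memv_cap Uu -[u](subrK (c *: w)).
by rewrite memvD ?memvZ // (subvP (capvSr U W)).
Qed.

Lemma moore_color_root U :
  moore_color U ^+ ((#|F| ^ \dim {:L}).-1 %/ #|F|.-1) = 1.
Proof.
rewrite /moore_color; set d := moore_det _ _; have d_neq0 : d != 0.
  exact: moore_det_neq0 (basis_free (vbasisP U)).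
rewrite -exprM mulnC divnK ?dvdn_pred_predX //; apply: (mulfI d_neq0).
rewrite -exprS prednK ?mulr1 ?expn_gt0 ?(ltnW (finNzRing_gt1 F)) //.
by apply/eqP; rewrite -(Fermat's_little_theorem {:L}%AS) memvf.
Qed.

End MooreDeterminant.
End FiniteFieldExtension.

(** * Gaussian numbers and general facts on colourings *)

Lemma gauss_binomial1 (q n : nat) :
  gauss_binomial q n 1 = ((q ^ n).-1 %/ q.-1)%N.
Proof.
by rewrite /gauss_binomial /gauss_num /gauss_den !big_nat1 subn0 expn1 !subn1.
Qed.

Lemma chromatic_number_colorable (G : sgraph) :
  colorable G (chromatic_number G).
Proof. by rewrite /chromatic_number; case: ex_minnP. Qed.

Lemma chromatic_number_le (G : sgraph) (T : eqType) (f : G -> T) (k : nat) :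
    (forall x y, adj x y -> f x != f y) -> (size (undup (codom f)) <= k)%N ->
  (chromatic_number G <= k)%N.
Proof.
move=> f_proper size_f; rewrite /chromatic_number; case: ex_minnP => c _; apply.
have mem_f x : f x \in undup (codom f) by rewrite mem_undup codom_f.
have lt_f x : (index (f x) (undup (codom f)) < k)%N.
  by rewrite (leq_trans _ size_f) // index_mem.
apply/existsP; exists [ffun x => Ordinal (lt_f x)].
apply/forallP => x; apply/forallP => y; apply/implyP => /f_proper.
rewrite !ffunE; apply: contra => /eqP[eq_xy].
by rewrite -(nth_index (f x) (mem_f x)) eq_xy nth_index.
Qed.

(** * The two bounds for the Grassmann graph *)

Section GrassmannChromatic.
Import passmx.
Local Open Scope ring_scope.
Variables (F : finFieldType) (n m : nat).

Lemma chromatic_grassmann_le : (0 < n)%N ->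
  (chromatic_number (grassmann_graph F n m) <= (#|F| ^ n).-1 %/ #|F|.-1)%N.
Proof.
move=> n_gt0; have [L dimL] := exists_finField_ext F n_gt0.
have [alpha alphaE] := Frobenius_gal L.
have [phi phi_inj] : exists phi : {linear 'rV[F]_n -> L}, injective phi.
  rewrite -dimL; exists (vecof (vbasis {:L}%VS)).
  exact: can_inj (vecofK (vbasisP _)).
have q_gt1 : (1 < #|F|)%N := finNzRing_gt1 F.
pose f (U : msubspace F n m) := moore_color phi alpha (val U).
apply: (@chromatic_number_le (grassmann_graph F n m) _ f).
  move=> U W /eqP adjUW; have [dimU dimW] := (eqP (valP U), eqP (valP W)).
  by apply: moore_color_adj; rewrite // ?dimU ?dimW.
(* A field has at most N roots of unity of order dividing N, for N > 0; here N = (q^n-1)/(q-1). *)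
apply: max_unity_roots; last exact: undup_uniq.
  rewrite divn_gt0 -!subn1 ?subn_gt0 // leq_sub2r //.
  by rewrite -[leqLHS]expn1 leq_pexp2l // ltnW.
apply/allP => z; rewrite mem_undup => /codomP[U ->].
by rewrite unity_rootE -[X in (_ ^ X)%N]dimL moore_color_root.
Qed.

Lemma exists_vspace_dim (vT : vectType F) d : (d <= \dim {:vT})%N ->
  exists W : {vspace vT}, \dim W = d.
Proof.
move=> le_d; exists <<take d (vbasis {:vT})>>%VS.
have := basis_free (vbasisP {:vT}); rewrite -{1}(cat_take_drop d (vbasis _)).
by move=> /catl_free/eqP->; rewrite size_takel ?size_tuple.
Qed.

(* The m-spaces through a fixed (m-1)-space W are spanned by W and a nonzero
   vector v of a complement of W, and determine v up to a scalar; so each colour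
   is taken by at most q-1 such vectors v. *)
Lemma chromatic_grassmann_ge : (0 < m)%N -> (m <= n)%N ->
  ((#|F| ^ (n - m + 1)).-1 %/ #|F|.-1
     <= chromatic_number (grassmann_graph F n m))%N.
Proof.
move=> m_gt0 le_mn; set k := chromatic_number _.
have q1_gt0 : (0 < #|F|.-1)%N by rewrite -subn1 subn_gt0 finNzRing_gt1.
have /existsP[/= f /forallP f_proper] :=
  chromatic_number_colorable (grassmann_graph F n m).
have dim_rV : \dim {:'rV[F]_n} = n by rewrite dimvf /dim /= mul1n.
have [W dimW] : exists W : {vspace 'rV[F]_n}, \dim W = m.-1.
  by apply: exists_vspace_dim; rewrite dim_rV (leq_trans (leq_pred m)).
have dimC : \dim W^C = (n - m + 1)%N.
  rewrite dimv_compl dim_rV dimW.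
  by case: m m_gt0 le_mn => // d _ lt_dn; rewrite addn1 subnSK.
have capWC : (W :&: W^C)%VS = 0%VS := capv_compl W.
have dimWv v : v \in (W^C)%VS -> v != 0 -> \dim (W + <[v]>) = m.
  move=> Cv v_neq0; rewrite dimv_disjoint_sum.
    by rewrite dim_vline v_neq0 dimW addn1 prednK.
  by apply/eqP; rewrite -subv0 -capWC capvS // -memvE.
have [v0 Cv0 v0_neq0] : exists2 v, v \in (W^C)%VS & v != 0.
  exists (vpick W^C); first exact: memv_pick.
  by rewrite vpick0 -dimv_eq0 dimC addn1.
(* [U0] is only the default value of [insubd], taken when [W + <[v]>] does not have dimension m. *)
pose U0 : msubspace F n m :=
  Sub (W + <[v0]>)%VS (introT eqP (dimWv v0 Cv0 v0_neq0)).
pose space v : msubspace F n m := insubd U0 (W + <[v]>)%VS.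
have val_space v : v \in (W^C)%VS -> v != 0 -> val (space v) = (W + <[v]>)%VS.
  by move=> Cv v_neq0; rewrite insubdK //; apply/eqP/dimWv.
pose A := [set v : 'rV[F]_n | (v \in (W^C)%VS) && (v != 0)].
have cardA : #|A| = (#|F| ^ (n - m + 1)).-1.
  rewrite -dimC -(@card_vspace F 'rV[F]_n (Vector.class 'rV[F]_n)).
  rewrite (cardD1 0 (mem (W^C)%VS)) mem0v /=; apply: eq_card => v.
  by rewrite !inE andbC.
have fibre (i : 'I_k) : (#|[set v in A | f (space v) == i]| <= #|F|.-1)%N.
  set Ai := finset _; have [->|[v]] := set_0Vmem Ai; first by rewrite cards0.
  rewrite !inE => /andP[/andP[Cv v_neq0] /eqP fv].
  (* The bound q - 1 counts the nonzero scalars c; the fibre lies in the set of the c v. *)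
  rewrite -(cardsC1 (0 : F)).
  apply: leq_trans (leq_imset_card (fun c : F => c *: v) _).
  apply/subset_leq_card/subsetP => u /[!inE] /andP[/andP[Cu u_neq0] /eqP fu].
  have /forallP/(_ (space v)) := f_proper (space u).
  rewrite fu fv eqxx implybF /= /grassmann_adj !val_space // => nadj.
  set I := (_ :&: _)%VS in nadj.
  have sWI : (W <= I)%VS by rewrite subv_cap !addvSl.
  (* I contains W, of dimension m - 1, and equal colours rule out dim I = m - 1; so both m-spaces
     equal I. *)
  have dimI : (m <= \dim I)%N.
    rewrite -(prednK m_gt0) -dimW ltn_neqAle dimvS // andbT dimW.
    by apply: contraNneq nadj => <-; rewrite prednK.
  have : (W + <[u]> <= W + <[v]>)%VS.
    have /eqP <- : I == (W + <[u]>)%VS by rewrite eqEdim capvSl dimWv.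
    exact: capvSr.
  move=> /subvP/(_ u); rewrite (subvP (addvSr _ _)) ?memv_line // => /(_ isT).
  case/memv_addP => w Ww [_ /vlineP[c ->] def_u].
  (* w = u - c v lies both in W and in its complement. *)
  have w0 : w = 0.
    apply/eqP; rewrite -memv0 -capWC memv_cap Ww /=.
    by rewrite -[w](addrK (c *: v)) -def_u memvB ?memvZ.
  rewrite w0 add0r in def_u; apply/imsetP; exists c => //.
  by rewrite !inE; apply: contraNneq u_neq0 => c0; rewrite def_u c0 scale0r.
(* It remains to bound [#|A|] by k (q-1), summing the fibres over the k colours. *)
rewrite -[k in (_ <= k)%N](mulnK k q1_gt0) leq_div2r // -cardA.
rewrite -sum1_card (partition_big (fun v => f (space v)) predT) //=.
rewrite -[k in leqRHS]card_ord -sum_nat_const leq_sum // => i _.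
rewrite (leq_trans _ (fibre i)) // -sum1_card; apply: eq_leq.
by apply: eq_bigl => v; rewrite inE.
Qed.

End GrassmannChromatic.

Theorem theorem1p2 (q : nat) (hq : prime_power q)
    (F : finFieldType) (hF : #|F| = q)
    (m n : nat) (hm : 0 < m) (hmn : m < n) :
  gauss_binomial q (n - m + 1) 1 <= chromatic_number (grassmann_graph F n m)
    <= gauss_binomial q n 1.
Proof.
rewrite !gauss_binomial1 -hF chromatic_grassmann_ge ?(ltnW hmn) //.
by rewrite chromatic_grassmann_le // (ltn_trans hm hmn).
Qed.
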